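(* Let $w\in\mathrm{F}(X_1,\ldots,X_d)$ be a reduced word, $w=x_1^{\epsilon_1}\cdots x_\ell^{\epsilon_\ell}$, where $\ell$ is the length of $w$ and, for $k=1,\ldots,\ell$, $x_k\in\{X_1,\ldots,X_d\}$ and $\epsilon_k\in\{\pm1\}$. Assume that for some given $i,j\in\{1,\ldots,\ell\}$ with $i<j$ and $x_i=x_j$, all $(i,j)$-split variations of $w$ are WMB. Then, if a finite semisimple group $H$ satisfies the identity $w\equiv1$, the permutation part $P(H)$ satisfies the identity $\Delta_{i,j}(w)\equiv1$. In particular, there is a nontrivial word $v\in\mathrm{F}(X_1,\ldots,X_d)$ of length strictly smaller than $\ell$ such that $P(H)$ satisfies the identity $v\equiv1$.
   Context: $\mathrm{F}(X_1,\ldots,X_d)$ is the free group freely generated by $X_1,\ldots,X_d$; its elements are called words. A group $G$ satisfies the identity $w\equiv1$ if $w(g_1,\ldots,g_d)=1$ for all $g_1,\ldots,g_d\in G$. With $w=x_1^{\epsilon_1}\cdots x_\ell^{\epsilon_\ell}$ as in the claim, for $k=1,\ldots,\ell$ set $I_k(w):=x_1^{\epsilon_1}\cdots x_{k-1}^{\epsilon_{k-1}}$ if $\epsilon_k=1$, and $I_k(w):=x_1^{\epsilon_1}\cdots x_k^{\epsilon_k}$ if $\epsilon_k=-1$. For $1\le i<j\le\ell$ set $\Delta_{i,j}(w):=I_i(w)^{-1}I_j(w)$. A variation of $w$ is a word obtained from $w$ by adding to each occurrence of $X_k^{\pm1}$ in $w$ (for each $k$) some second index, i.e. the occurrence is replaced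 by $X_{k,m}^{\pm1}$ for some $m$ depending on the occurrence, where the $X_{k,m}$ are pairwise distinct variables. A variation $w'=y_1^{\epsilon_1}\cdots y_\ell^{\epsilon_\ell}$ of $w$ is $(i,j)$-split if $x_i=x_j$ and $y_i\ne y_j$. For a nonabelian finite simple group $S$ (identified with $\mathrm{Inn}(S)\le\mathrm{Aut}(S)$), a word $u$ in $d'$ variables is a coset identity over $S$ if there are $\alpha_1,\ldots,\alpha_{d'}\in\mathrm{Aut}(S)$ such that the word map $u_{\mathrm{Aut}(S)}$ is constant on $S\alpha_1\times\cdots\times S\alpha_{d'}$. A nontrivial word is WMB if it is not a coset identity over any nonabelian finite simple group. A finite group $H$ is semisimple if it has no nontrivial solvable normal subgroup. If $H$ is a nontrivial finite semisimple group, then up to isomorphism $S_1^{n_1}\times\cdots\times S_r^{n_r}\le H\le\mathrm{Aut}(S_1^{n_1}\times\cdots\times S_r^{n_r})=(\mathrm{Aut}(S_1)\wr\mathrm{Sym}(n_1))\times\cdots\times(\mathrm{Aut}(S_r)\wr\mathrm{Sym}(n_r))$, where $S_1,\ldots,S_r$ are pairwise nonisomorphic nonabelian finite simple groups, $n_1,\ldots,n_r\in\mathbb{N}^+$ and $S_1^{n_1}\times\cdots\times S_r^{n_r}$ is the socle of $H$. The permutation part of $H$ is $P(H):=H/(H\cap(\mathrm{Aut}(S_1)^{n_1}\times\cdots\times\mathrm{Aut}(S_r)^{n_r}))$, naturally a subgroup of $\mathrm{Sym}(n_1)\times\cdots\times\mathrm{Sym}(n_r)$. For trivial $H$, $P(H)$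 is the trivial group. *)

(* Defs.v *)
From HB Require Import structures.
From mathcomp Require Import all_boot all_fingroup all_solvable.

Set Implicit Arguments.
Unset Strict Implicit.
Unset Printing Implicit Defensive.

Local Open Scope group_scope.

(* The free group on an alphabet A.  Its elements are the reduced words, so   *)
(* that the length of a word is its [size].  The letter (a, true) stands for  *)
(* a, the letter (a, false) for its formal inverse.                           *)

Section FreeGroup.

Variable A : choiceType.
Implicit Types (a : A * bool) (s t : seq (A * bool)).

Definition inv_letter a := (a.1, ~~ a.2).

Definition reduced s := sorted (fun a b => b != inv_letter a) s.

Record free_group := FreeGroup {
  word_of :> seq (A * bool);
  word_ofP : reduced word_of
}.

HB.instance Definition _ := [isSub for word_of].
HB.instance Definition _ := [Choice of free_group by <:].

(* Left multiplication of a reduced word by a letter. *)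
Definition push a s :=
  if s is b :: t then if b == inv_letter a then t else a :: s else [:: a].

Lemma inv_letterK : involutive inv_letter.
Proof. by case=> x e; rewrite /inv_letter /= negbK. Qed.

Lemma push_reduced a s : reduced s -> reduced (push a s).
Proof.
case: s => [|b s] //=; case: ifPn => [_ | neq_ba sP /=]; last by rewrite neq_ba.
exact: path_sorted.
Qed.

Lemma push_cons a s : reduced (a :: s) -> push a s = a :: s.
Proof. by case: s => [|b s] //= /andP[/negPf->]. Qed.

Lemma pushK a s : reduced s -> push a (push (inv_letter a) s) = s.
Proof.
case: s => [|b s] /=; first by rewrite eqxx.
rewrite inv_letterK; case: eqVneq => [-> sP | _ _ /=]; last by rewrite eqxx.
exact: push_cons.
Qed.

Lemma foldr_push_reduced s t : reduced t -> reduced (foldr push t s).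
Proof. by move=> tP; elim: s => //= a s; apply: push_reduced. Qed.

Lemma foldr_push_push a s t :
  reduced t -> foldr push t (push a s) = push a (foldr push t s).
Proof.
move=> tP; case: s => [|b s] //=; case: eqP => //= ->.
by rewrite pushK // foldr_push_reduced.
Qed.

Definition free_one := @FreeGroup [::] isT.

Definition free_mul (u v : free_group) :=
  FreeGroup (foldr_push_reduced u (word_ofP v)).

Lemma inv_word_reduced s : reduced s -> reduced (rev (map inv_letter s)).
Proof.
rewrite /reduced rev_sorted sorted_map.
apply: sub_sorted => a b /= neq_ba; rewrite (can_eq inv_letterK).
by apply: contraNneq neq_ba => ->; rewrite inv_letterK.
Qed.

Definition free_inv (u : free_group) :=
  FreeGroup (inv_word_reduced (word_ofP u)).

Lemma free_mulA : associative free_mul.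
Proof.
move=> u v t; apply: val_inj => /=; elim: (word_of u) => //= a s ->.
by rewrite foldr_push_push // word_ofP.
Qed.

Lemma free_mul1 : left_id free_one free_mul.
Proof. by move=> u; apply: val_inj. Qed.

Lemma free_mulr1 : right_id free_one free_mul.
Proof.
case=> s sP; apply: val_inj => /=; elim: s sP => //= a s IHs sP.
by rewrite IHs ?push_cons //; apply: path_sorted sP.
Qed.

Lemma free_mulV : left_inverse free_one free_inv free_mul.
Proof.
case=> s sP; apply: val_inj => /=; elim: s sP => //= a s IHs sP.
by rewrite rev_cons foldr_rcons /= inv_letterK eqxx IHs //; apply: path_sorted sP.
Qed.

Lemma free_invK : involutive free_inv.
Proof.
case=> s sP; apply: val_inj; rewrite /= map_rev revK mapK //.
exact: inv_letterK.
Qed.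

Lemma free_mulrV : right_inverse free_one free_inv free_mul.
Proof. by move=> u; rewrite -{1}[u]free_invK free_mulV. Qed.

HB.instance Definition _ := isGroup.Build free_group
  free_mulA free_mul1 free_mulr1 free_mulV free_mulrV.

Definition gen (x : A) : free_group := @FreeGroup [:: (x, true)] isT.

Definition eval_word (G : groupType) (g : A -> G) s : G :=
  \prod_(a <- s) (if a.2 then g a.1 else (g a.1)^-1).

Definition satisfies (gT : finGroupType) (G : {set gT}) (u : free_group) :=
  forall g : A -> gT, (forall x, g x \in G) -> eval_word g u = 1.

Definition letter_var s k : option A := onth (unzip1 s) k.

End FreeGroup.

(* Positions in a word are counted from 0 here: for k < size w, the letter at *)
(* position k is x_(k+1)^(eps_(k+1)) and [Iword w k] is I_(k+1)(w).           *)

Definition Iword (A : choiceType) (w : free_group A) (k : nat) : free_group A :=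
  eval_word (@gen A)
    (if nth true (unzip2 w) k then take k w else take k.+1 w).

Definition Delta (A : choiceType) (w : free_group A) (i j : nat) :=
  (Iword w i)^-1 * Iword w j.

(* The variable X_{k,m} is the pair (k, m); a variation of a reduced word is  *)
(* automatically reduced.                                                     *)
Definition variation (A : choiceType)
    (w : free_group A) (w' : free_group (A * nat)%type) :=
  [seq (a.1.1, a.2) | a <- w'] = w.

Definition split_variation (A : choiceType) (i j : nat)
    (w : free_group A) (w' : free_group (A * nat)%type) :=
  [/\ variation w w', letter_var w i = letter_var w j &
      letter_var w' i <> letter_var w' j].

Definition Inn (gT : finGroupType) (G : {group gT}) : {group {perm gT}} :=
  (conj_aut G @* G)%G.

(* The alphabet A may be infinite: only the finitely many variables occurring *)
(* in u matter.                                                               *)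
Definition coset_identity (A : choiceType) (gT : finGroupType)
    (S : {group gT}) (u : free_group A) :=
  exists2 alpha : A -> {perm gT}, (forall x, alpha x \in Aut S) &
    forall g h : A -> {perm gT},
      (forall x, g x \in Inn S :* alpha x) ->
      (forall x, h x \in Inn S :* alpha x) ->
      eval_word g u = eval_word h u.

Definition WMB (A : choiceType) (u : free_group A) :=
  u <> 1 /\
  forall (gT : finGroupType) (S : {group gT}),
    simple S -> ~~ abelian S -> ~ coset_identity S u.

Definition semisimple (gT : finGroupType) (H : {group gT}) :=
  forall N : {group gT}, N <| H -> solvable N -> N :=: 1.

Definition socle (gT : finGroupType) (H : {group gT}) : {group gT} :=
  <<\bigcup_(M : {group gT} | minnormal M H && (M \subset H)) M>>%G.

(* S_1^(n_1) x ... x S_r^(n_r) *)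

Definition pow_group (G : finGroupType) (n : nat) : finGroupType :=
  {dffun forall _ : 'I_n, G}.

Definition prod_pow (r : nat) (S : 'I_r -> finGroupType) (n : 'I_r -> nat) :
  finGroupType := {dffun forall i : 'I_r, pow_group (S i) (n i)}.

(* Aut(S_1)^(n_1) x ... x Aut(S_r)^(n_r), as a subgroup of                    *)
(* Aut(S_1^(n_1) x ... x S_r^(n_r)) acting coordinatewise.                    *)

Section BaseAut.

Variables (r : nat) (S : 'I_r -> finGroupType) (n : 'I_r -> nat).

Definition base_aut : {set {perm (prod_pow S n)}} :=
  [set f : {perm (prod_pow S n)} |
    [exists a : prod_pow (fun i => {perm (S i)}) n,
      [forall i, forall k : 'I_(n i), a i k \in Aut [set: S i]] &&
      [forall x : prod_pow S n, forall i, forall k : 'I_(n i),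
         f x i k == a i k (x i k)]]].

Lemma base_autP (f : {perm (prod_pow S n)}) :
  reflect (exists2 a : prod_pow (fun i => {perm (S i)}) n,
             forall i k, a i k \in Aut [set: S i] &
             forall x i k, f x i k = a i k (x i k))
          (f \in base_aut).
Proof.
rewrite inE; apply: (iffP existsP) => [[a /andP[aP fP]] | [a aP fP]]; exists a.
- by move=> i k; move/forallP/(_ i)/forallP/(_ k): aP.
- by move=> x i k; move/forallP/(_ x)/forallP/(_ i)/forallP/(_ k)/eqP: fP.
apply/andP; split; first by apply/forallP=> i; apply/forallP=> k.
by apply/forallP=> x; apply/forallP=> i; apply/forallP=> k; rewrite fP.
Qed.

Lemma base_aut_group_set : group_set base_aut.
Proof.
apply/group_setP; split=> [|f g /base_autP[a aP fP] /base_autP[b bP gP]].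
  by apply/base_autP; exists 1 => [i k | x i k]; rewrite !oneg_ffun ?group1 ?perm1.
apply/base_autP; exists (a * b) => [i k | x i k]; rewrite !dffunM ?groupM //.
by rewrite !permM gP fP.
Qed.

Canonical base_aut_group := Group base_aut_group_set.

End BaseAut.

(* P is, up to isomorphism, the permutation part P(H).  The injective         *)
(* morphism phi is the identification of H with a group lying between the     *)
(* socle S_1^(n_1) x ... x S_r^(n_r) (as inner automorphisms) and its full    *)
(* automorphism group.                                                        *)
Definition permutation_part (gT : finGroupType) (H : {group gT})
    (pT : finGroupType) (P : {group pT}) : Prop :=
  if H :==: 1 then P :=: 1 else
  exists (r : nat) (S : 'I_r -> finGroupType) (n : 'I_r -> nat)
         (phi : {morphism H >-> {perm (prod_pow S n)}}),
  [/\ forall i, simple [set: S i] /\ ~~ abelian [set: S i],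
      forall i j, i != j -> ~~ ([set: S i] \isog [set: S j]),
      forall i, 0 < n i,
      [/\ 'injm phi, phi @* H \subset Aut [set: prod_pow S n],
          Inn [set: prod_pow S n] \subset phi @* H &
          socle (phi @* H) :=: Inn [set: prod_pow S n]] &
      P \isog (phi @* H) / (phi @* H :&: base_aut S n)].

(* Main.v *)
(* Every automorphism f of S_1^(n_1) x ... x S_r^(n_r) permutes the factors:  *)
(* its coordinate k reads f x i k = a (x i m) with a in Aut(S_i) and m the    *)
(* preimage of k.  Suppose that Delta_{i,j}(w), evaluated at g_1, ..., g_d in *)
(* H, moves a coordinate.  Replace each g_x by t_x g_x with t_x in the socle. *)
(* On a suitable coordinate of w(t_1 g_1, ..., t_d g_d) = 1 the k-th letter   *)
(* x_k only sees the entry of t_(x_k) at the image of the starting coordinate *)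
(* under I_k(w).  These images differ for k = i and k = j, so that this       *)
(* coordinate is a word map of an (i,j)-split variation of w on arbitrary     *)
(* cosets of Inn(S), and it is constantly 1, contradicting WMB.               *)

Require Import Defs.
From HB Require Import structures.
From mathcomp Require Import all_boot all_fingroup all_solvable.

Set Implicit Arguments.
Unset Strict Implicit.
Unset Printing Implicit Defensive.

Local Open Scope group_scope.

(** By [aut_carries], an automorphism of the product permutes the coordinates belonging to each
    simple factor and twists the entries. By [carries_word], following a word from one coordinate
    evaluates its [split_word], whose variables are labelled by the coordinates visited. If Delta
    moved a coordinate m to k, [Delta_base_aut] would choose the start so that letters i and j get
    the labels m and k; the split word would then be a coset identity, against WMB. For the shorter
    word, [Delta_or_conjugate] takes Delta itself unless it has full length; then w = x u x^-1, and
    u serves. *)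

Section Words.

(** * Evaluation of words and of Delta *)

Variable A : choiceType.
Implicit Types (s t : seq (A * bool)) (u v w : free_group A).

Definition prefix_of_letter s k :=
  if nth true (unzip2 s) k then take k s else take k.+1 s.

Lemma eval_word_cons (G : groupType) (g : A -> G) a s :
  eval_word g (a :: s) = (if a.2 then g a.1 else (g a.1)^-1) * eval_word g s.
Proof. by rewrite /eval_word big_cons. Qed.

Lemma eval_word_cat (G : groupType) (g : A -> G) s t :
  eval_word g (s ++ t) = eval_word g s * eval_word g t.
Proof. by rewrite /eval_word big_cat. Qed.

Lemma eval_word_morph (G K : groupType) (f : G -> K) (g : A -> G) s :
    f 1 = 1 -> {morph f : x y / x * y} ->
  f (eval_word g s) = eval_word (f \o g) s.
Proof.
move=> f1 fM; have fV x : f x^-1 = (f x)^-1.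
  by apply: (mulgI (f x)); rewrite -fM !mulgV f1.
elim: s => [|a s IHs]; first by rewrite /eval_word !big_nil.
by rewrite !eval_word_cons fM IHs; case: ifP; rewrite ?fV.
Qed.

Lemma eval_push (G : groupType) (g : A -> G) a s :
  eval_word g (push a s) = eval_word g (a :: s).
Proof.
case: s => [|b s] //=; case: eqP => // ->; rewrite !eval_word_cons mulgA /=.
by case: a => x [] /=; rewrite ?mulgV ?mulVg mul1g.
Qed.

Lemma eval_wordM (G : groupType) (g : A -> G) u v :
  eval_word g (u * v) = eval_word g u * eval_word g v.
Proof.
rewrite -eval_word_cat; have -> : u * v = foldr (@push A) v u :> seq _ by [].
by elim: (word_of u) => //= a s IHs; rewrite eval_push !eval_word_cons IHs.
Qed.

Lemma eval_word1 (G : groupType) (g : A -> G) :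
  eval_word g (1 : free_group A) = 1.
Proof. by rewrite /eval_word big_nil. Qed.

Lemma eval_wordV (G : groupType) (g : A -> G) u :
  eval_word g u^-1 = (eval_word g u)^-1.
Proof.
by apply: (mulgI (eval_word g u)); rewrite -eval_wordM !mulgV eval_word1.
Qed.

(** Evaluation at g is a homomorphism fixed by the generators, so the reduction hidden in [Iword]
    does not change values and Delta can be computed from plain prefixes. *)
Lemma eval_word_gen (G : groupType) (g : A -> G) s :
  eval_word g (eval_word (@gen A) s) = eval_word g s.
Proof.
rewrite (eval_word_morph (f := fun u => eval_word g (word_of u))).
- apply: eq_bigr => a _ /=.
  by rewrite eval_word_cons /= [eval_word g [::]]big_nil mulg1.
- exact: eval_word1.
- exact: eval_wordM.
Qed.

Lemma word_of_eval_gen s : reduced s -> eval_word (@gen A) s = s :> seq _.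
Proof.
elim: s => [|a s IHs] sP; first by rewrite /eval_word big_nil.
rewrite eval_word_cons; case: a sP => x [] sP /=; rewrite IHs ?push_cons //;
  exact: path_sorted sP.
Qed.

Lemma eval_Delta (G : groupType) (g : A -> G) w i j :
  eval_word g (Delta w i j) =
  (eval_word g (prefix_of_letter w i))^-1 *
    eval_word g (prefix_of_letter w j).
Proof. by rewrite eval_wordM eval_wordV !eval_word_gen. Qed.

Lemma prefix_of_letter_cons a s k :
  prefix_of_letter (a :: s) k.+1 = a :: prefix_of_letter s k.
Proof. by rewrite /prefix_of_letter /=; case: nth. Qed.

Lemma reduced_cat s t : reduced (s ++ t) -> reduced s /\ reduced t.
Proof.
case: s => //= a s; rewrite cat_path => /andP[-> /path_sorted] //.
Qed.

Lemma Delta_infix w i j s t v :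
    prefix_of_letter w i = s -> prefix_of_letter w j = s ++ t ->
  reduced t -> Delta w i j = t :> seq _.
Proof.
rewrite /Delta /Iword -!/(prefix_of_letter _ _) => -> -> tP.
by rewrite eval_word_cat mulKg word_of_eval_gen.
Qed.

End Words.

(** * Variations of a word labelled by an orbit *)

Section SplitWord.

Variables (A : choiceType) (n : nat) (sigma : A -> {perm 'I_n}).

(* Reading s from left to right moves the point m along the action sigma; the *)
(* occurrence of a variable x is renamed after the point to which x applies.  *)
Fixpoint split_word (m : 'I_n) (s : seq (A * bool)) : seq ((A * nat) * bool) :=
  if s is a :: s' then
    let k := (if a.2 then sigma a.1 else (sigma a.1)^-1) m in
    ((a.1, val (if a.2 then m else k)), a.2) :: split_word k s'
  else [::].

Lemma split_wordK m s : [seq (a.1.1, a.2) | a <- split_word m s] = s.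
Proof. by elim: s m => //= -[x e] s IHs m; rewrite IHs. Qed.

Lemma split_word_reduced m s : reduced s -> reduced (split_word m s).
Proof.
rewrite -{1}(split_wordK m s) /reduced sorted_map.
by apply: sub_sorted => a b /=; apply: contraNneq => ->.
Qed.

(** An inverse letter is labelled by the point where it arrives, since x itself departs from there.
    This matches the two cases of I_k, so every label is the image of the start under the
    corresponding prefix. *)
Lemma onth_split_word m s k :
  onth (unzip1 (split_word m s)) k =
  omap (fun x => (x, val (eval_word sigma (prefix_of_letter s k) m)))
    (onth (unzip1 s) k).
Proof.
elim: s m k => [|[x e] s IHs] m [|k] //=; last first.
  by rewrite prefix_of_letter_cons eval_word_cons permM IHs.
rewrite /prefix_of_letter /= take0.
case: e => /=; first by rewrite /eval_word big_nil perm1.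
by rewrite /eval_word big_seq1.
Qed.

End SplitWord.

(** * Transfer of identities along morphisms *)

Section Satisfies.

Variable A : choiceType.

Lemma eval_word_in (gT : finGroupType) (G : {group gT}) (g : A -> gT) s :
  (forall x, g x \in G) -> eval_word g s \in G.
Proof.
move=> Gg; rewrite /eval_word group_prod // => a _.
by case: ifP; rewrite ?groupV.
Qed.

Lemma eval_word_morphim (aT rT : finGroupType) (D : {group aT})
    (f : {morphism D >-> rT}) (g : A -> aT) s :
  (forall x, g x \in D) -> f (eval_word g s) = eval_word (f \o g) s.
Proof.
move=> Dg; elim: s => [|a s IHs]; first by rewrite /eval_word !big_nil morph1.
rewrite !eval_word_cons morphM ?IHs ?eval_word_in //; last first.
  by case: ifP; rewrite ?groupV.
by case: ifP; rewrite ?morphV.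
Qed.

Lemma satisfies_morphim (aT rT : finGroupType) (D : {group aT})
    (f : {morphism D >-> rT}) (G : {group aT}) (u : free_group A) :
    (forall g : A -> aT, (forall x, g x \in D :&: G) ->
       f (eval_word g u) = 1) ->
  satisfies (f @* G) u.
Proof.
move=> f_u g Gg.
have lift x : exists y, (y \in D :&: G) && (f y == g x).
  have /morphimP[y Dy Gy ->] := Gg x.
  by exists y; rewrite inE Dy Gy eqxx.
have gE x := andP (xchooseP (lift x)).
rewrite -(f_u (fun x => xchoose (lift x))) => [|x]; last by case: (gE x).
rewrite eval_word_morphim => [|x]; last by have [/setIP[]] := gE x.
by apply: eq_bigr => a _ /=; have [_ /eqP->] := gE a.1.
Qed.

Lemma satisfies_isog (aT rT : finGroupType) (G : {group aT}) (H : {group rT})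
    (u : free_group A) :
  G \isog H -> satisfies G u -> satisfies H u.
Proof.
case/isogP=> f _ <- Gu; apply: satisfies_morphim => g Gg.
by rewrite Gu ?morph1 // => x; have /setIP[] := Gg x.
Qed.

End Satisfies.

(* Delta is the infix of w between two prefixes; it is all of w exactly when  *)
(* w = x u x^-1 with x = x_i = x_j, and then u can replace it.                *)
Lemma Delta_or_conjugate (A : choiceType) (w : free_group A)
    (i j : 'I_(size w)) :
    (i < j)%N -> letter_var w i = letter_var w j ->
  exists v : free_group A, [/\ v <> 1, (size v < size w)%N &
    forall (gT : finGroupType) (P : {group gT}),
      satisfies P (Delta w i j) -> satisfies P v].
Proof.
move=> lt_ij eq_xij; have wP := word_ofP w.
have [a0 _] : exists a0 : A * bool, True.
  by case: (word_of w) i {lt_ij j eq_xij wP} => [[]|a ? _] //; exists a.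
have letterE (k : 'I_(size w)) :
    letter_var w k = Some (nth a0 w k).1 /\
    nth true (unzip2 w) k = (nth a0 w k).2.
  rewrite /letter_var onthE.
  by rewrite !(nth_map (Some a0.1), nth_map a0.1, nth_map a0) ?size_map.
have [[xi ei] [xj ej]] := (letterE i, letterE j).
have eq_x : (nth a0 w i).1 = (nth a0 w j).1.
  by apply: Some_inj; rewrite -xi -xj.
pose p (k : 'I_(size w)) := if (nth a0 w k).2 then k : nat else k.+1.
have prefE (k : 'I_(size w)) : prefix_of_letter w k = take (p k) w.
  by rewrite /prefix_of_letter; have [_ ->] := letterE k; rewrite /p; case: ifP.
have p_le (k : 'I_(size w)) : (k <= p k <= k.+1)%N.
  by rewrite /p; case: ifP; rewrite leqnSn leqnn.
have [/andP[le_ipi le_pi] /andP[le_jpj le_pj]] := (p_le i, p_le j).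
have le_pij : (p i <= p j)%N by apply: leq_trans le_pi (leq_trans lt_ij le_jpj).
have le_pjw : (p j <= size w)%N by apply: leq_trans le_pj (ltn_ord j).
set t := drop (p i) (take (p j) w).
have cat_t : take (p j) w = take (p i) w ++ t.
  by rewrite -[LHS](cat_take_drop (p i)) take_takel.
have tP : reduced t.
  have [takeP _] : reduced (take (p j) w) /\ reduced (drop (p j) w).
    by apply: reduced_cat; rewrite cat_take_drop.
  by rewrite cat_t in takeP; have [] := reduced_cat takeP.
have DeltaE : Delta w i j = t :> seq _.
  exact: Delta_infix (prefE i) (etrans (prefE j) cat_t) tP.
have szt : size t = (p j - p i)%N by rewrite size_drop size_takel.
have neq_inv (k : nat) : (k.+1 < size w)%N ->
    nth a0 w k.+1 != inv_letter (nth a0 w k).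
  by move/(sortedP a0): wP; apply.
(* Equal cut points would force j = i + 1 with x^-1 followed by x, which reducedness forbids. *)
have t_gt0 : (0 < size t)%N.
  rewrite szt subn_gt0 ltn_neqAle le_pij andbT; apply/negP=> /eqP eq_p.
  have eq_j : j = i.+1 :> nat.
    by apply/eqP; rewrite eqn_leq lt_ij (leq_trans le_jpj) // -eq_p.
  have := neq_inv i; rewrite -eq_j ltn_ord => /(_ isT)/eqP; apply.
  move: eq_p; rewrite /p eq_j; case ei2: (nth a0 w i).2.
    by case: ifP => _ /eqP; rewrite ltn_eqF // ltnW.
  rewrite -eq_j; case ej2: (nth a0 w j).2; last by move/eqP; rewrite ltn_eqF.
  by rewrite /inv_letter ei2 eq_x /= -ej2; case: (nth a0 w j).
have [lt_t|ge_t] := ltnP (size t) (size w).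
  exists (Delta w i j); split=> [D1||//]; last by rewrite DeltaE.
  by move: t_gt0; rewrite -DeltaE D1.
(* An infix of full length has cut points 0 and [size w], so w starts with x and ends with x^-1. *)
have pj_w : p j = size w.
  apply/eqP; rewrite eqn_leq le_pjw; apply: leq_trans ge_t _.
  by rewrite szt leq_subr.
have w_gt0 : (0 < size w)%N by apply: leq_ltn_trans (ltn_ord i).
have pi_0 : p i = 0%N.
  apply/eqP; move: ge_t; rewrite szt pj_w leqNgt ltn_subrL w_gt0 andbT.
  by rewrite lt0n negbK.
have [i0 ei1] : i = 0%N :> nat /\ (nth a0 w i).2 = true.
  by move: pi_0; rewrite /p; case: ifP.
have [jw ej0] : j.+1 = size w /\ (nth a0 w j).2 = false.
  by move: pj_w; rewrite /p; case: ifP => // _ jE;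
     have := ltn_ord j; rewrite jE ltnn.
have wE : t = w by rewrite /t pi_0 pj_w drop0 take_size.
rewrite wE in DeltaE.
have [x [u defw]] : exists x u, w = (x, true) :: rcons u (x, false) :> seq _.
  have jE : nat_of_ord j = (size w).-1 by apply: succn_inj; rewrite jw prednK.
  move: lt_ij ei1 ej0 eq_x; rewrite jE i0; move: (word_of w).
  case=> [|[x e] s] //; case/lastP: s => [|u [y e']] //=.
  rewrite size_rcons /= nth_rcons ltnn eqxx /= => _ -> -> ->.
  by exists y, u.
have [_] : reduced [:: (x, true)] /\ reduced (rcons u (x, false)).
  by apply: reduced_cat; rewrite cat1s -defw.
rewrite -cats1 => /reduced_cat[uP _].
exists (FreeGroup uP); split=> [[u1]||gT P satw g Pg].
- by move: wP; rewrite defw u1 /reduced /= eqxx.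
- by rewrite defw /= size_rcons ltnW.
(* The value of w is a conjugate of the value of u. *)
apply: (conjg_inj (g x)^-1); rewrite conj1g -[RHS](satw g Pg) DeltaE defw.
rewrite eval_word_cons -cats1 eval_word_cat /eval_word big_seq1 /=.
by rewrite conjgE invgK.
Qed.

(** * Automorphisms of a product of simple groups, coordinate by coordinate *)

Section Coordinates.

Variables (r : nat) (S : 'I_r -> finGroupType) (n : 'I_r -> nat).
Local Notation T := (prod_pow S n).
Implicit Types (f g : {perm T}) (x y : T).

Definition carries f i (m k : 'I_(n i)) (a : {perm S i}) :=
  forall x : T, f x i k = a (x i m).

Lemma carries1 i (m : 'I_(n i)) : carries 1 m m 1.
Proof. by move=> x; rewrite !perm1. Qed.

Lemma carriesM f g i (m k l : 'I_(n i)) a b :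
  carries f m k a -> carries g k l b -> carries (f * g) m l (a * b).
Proof. by move=> fP gP x; rewrite !permM gP fP. Qed.

Lemma carriesV f i (m k : 'I_(n i)) a :
  carries f m k a -> carries f^-1 k m a^-1.
Proof. by move=> fP x; apply: (@perm_inj _ a); rewrite -fP !permKV. Qed.

Definition inj_coord i (k : 'I_(n i)) (s : S i) : T :=
  @dfung1 _ (fun i => pow_group (S i) (n i)) i (@dfung1 _ (fun=> S i) k s).

Lemma inj_coord_id i (k : 'I_(n i)) s : inj_coord k s i k = s.
Proof. by rewrite /inj_coord dfung1_id dfung1_id. Qed.

Lemma inj_coord_neq i (k l : 'I_(n i)) s : k != l -> inj_coord k s i l = 1.
Proof. by move=> neq_kl; rewrite /inj_coord dfung1_id dfung1_dflt. Qed.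

Lemma inj_coord_neq_factor i j (k : 'I_(n i)) (l : 'I_(n j)) s :
  i != j -> inj_coord k s j l = 1.
Proof. by move=> neq_ij; rewrite /inj_coord dfung1_dflt // oneg_ffun. Qed.

Lemma inj_coordM i (k : 'I_(n i)) : {morph @inj_coord i k : s t / s * t}.
Proof. by move=> s t; rewrite /inj_coord !dfung1_morphM. Qed.

Lemma prod_powM x y i k : (x * y) i k = x i k * y i k.
Proof. by rewrite !mulg_ffun. Qed.

Lemma prod_powV x i k : x^-1 i k = (x i k)^-1.
Proof. by rewrite !invg_ffun. Qed.

Lemma prod_pow1 i k : (1 : T) i k = 1.
Proof. by rewrite !oneg_ffun. Qed.

Lemma prod_powP x y : (forall i k, x i k = y i k) -> x = y.
Proof. by move=> eq_xy; apply/ffunP=> i; apply/ffunP=> k. Qed.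

Lemma inj_coord_conj i (k : 'I_(n i)) s y :
  inj_coord k s ^ y = inj_coord k (s ^ y i k).
Proof.
apply: prod_powP => i' k'; rewrite !prod_powM prod_powV.
have [eq_i|neq_i] := eqVneq i i'; last first.
  by rewrite !inj_coord_neq_factor // mul1g mulVg.
subst i'; have [<-|neq_k] := eqVneq k k'; first by rewrite !inj_coord_id.
by rewrite !inj_coord_neq // mul1g mulVg.
Qed.

Lemma prod_inj_coord x : x = \prod_i \prod_k inj_coord k (x i k).
Proof.
apply: prod_powP => i k; rewrite !prodg_ffun (big_only1 i) //; last first.
  move=> i' neq_i _; rewrite !prodg_ffun big1 // => k' _.
  by rewrite inj_coord_neq_factor.
rewrite !prodg_ffun (big_only1 k) ?inj_coord_id // => k' neq_k _.
by rewrite inj_coord_neq.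
Qed.

Hypothesis simpleS : forall i, simple [set: S i] /\ ~~ abelian [set: S i].

(** A nontrivial entry placed in coordinate m alone is invisible from any other source, so the
    source is unique; such elements then determine the twist. *)
Lemma carries_inj f i (m m' k : 'I_(n i)) a a' :
  carries f m k a -> carries f m' k a' -> m = m' /\ a = a'.
Proof.
move=> fP fP'; have aE x : a (x i m) = a' (x i m') by rewrite -fP.
suff eq_m: m = m'.
  split=> //; apply/permP=> s; have:= aE (inj_coord m s).
  by rewrite -eq_m !inj_coord_id.
apply/eqP; apply: contraT => neq_m.
have [/simpleP[/trivgPn[s _ /eqP nt_s] _] _] := simpleS i; case: nt_s.
apply: (@perm_inj _ a); have:= aE (inj_coord m s); have:= aE 1.
by rewrite !prod_pow1 inj_coord_id (inj_coord_neq _ neq_m) => <-.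
Qed.

Hypothesis nonisoS :
  forall i j, i != j -> ~~ ([set: S i] \isog [set: S j]).

(* The k-th coordinate of f is an epimorphism from T onto a nonabelian simple *)
(* group; commuting direct factors cannot both map onto it, so it factors     *)
(* through the projection of T onto a single direct factor.                   *)
Lemma aut_carries f i (k : 'I_(n i)) : f \in Aut [set: T] ->
  exists m a, a \in Aut [set: S i] /\ carries f m k a.
Proof.
move=> fAut; pose p x : S i := f x i k.
have pM : {morph p : x y / x * y}.
  move=> x y; rewrite /p -prod_powM.
  by have -> := morphicP (Aut_morphic fAut) x y (in_setT x) (in_setT y).
have p_surj z : exists x, p x = z.
  by exists (f^-1 (inj_coord k z)); rewrite /p permKV inj_coord_id.
have p1 : p 1 = 1 by apply: (mulgI (p 1)); rewrite -pM !mulg1.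
have pV x : p x^-1 = (p x)^-1 by apply: (mulgI (p x)); rewrite -pM !mulgV p1.
have [/simpleP[ntSi simpleSi] nabSi] := simpleS i.
(* T is generated by its factors and p is onto a nontrivial group, so p cannot kill every factor. *)
have [j [m [s ps]]] : exists j (m : 'I_(n j)) s, p (inj_coord m s) != 1.
  have /trivgPn[z _ nt_z] := ntSi; have [x px] := p_surj z.
  have [|/existsPn all1] :=
    boolP [exists j, exists m : 'I_(n j), p (inj_coord m (x j m)) != 1].
    by case/existsP=> j /existsP[m ?]; exists j, m, (x j m).
  case/eqP: nt_z; rewrite -px (prod_inj_coord x).
  rewrite (big_morph p pM p1) big1 // => j _; rewrite (big_morph p pM p1) big1 // => m _; apply/eqP.
  by have /existsPn/(_ m) := all1 j; rewrite negbK.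
pose q s := p (inj_coord m s).
have qM : {in [set: S j] &, {morph q : s t / s * t}}.
  by move=> u v _ _; rewrite /q inj_coordM pM.
pose qm := Morphism qM.
(* A factor is normal in T and p is onto, so its image is a nontrivial normal subgroup of a simple
   group. *)
have q_onto : qm @* [set: S j] = [set: S i].
  have nrm : qm @* [set: S j] <| [set: S i].
    rewrite /normal subsetT; apply/subsetP=> z _; rewrite inE.
    have [y <-] := p_surj z.
    apply/subsetP=> _ /imsetP[_ /morphimP[u _ _ ->] ->].
    have -> : qm u ^ p y = qm (u ^ y j m).
      by rewrite /= /q -inj_coord_conj /conjg !pM pV.
    by rewrite mem_morphim ?inE.
  have [im1|//] := simpleSi [group of qm @* [set: S j]] nrm.
  have: qm s \in qm @* [set: S j] by rewrite mem_morphim ?inE.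
  by rewrite (im1 : qm @* _ = 1) => /set1P qs1; rewrite -/(q s) -qs1 eqxx in ps.
have q_inj : 'injm qm.
  have [/simpleP[_ simpleSj] _] := simpleS j.
  have [/= ->|kerT] := simpleSj _ (ker_normal qm); first exact: subxx.
  have: s \in 'ker qm by rewrite (kerT : 'ker qm = _) inE.
  by move/mker=> /= qs1; rewrite -/(q s) qs1 eqxx in ps.
have eq_ji : j = i.
  apply/eqP; apply: contraT => /nonisoS/negP[].
  by apply/isogP; exists qm.
subst j.
(* The discrepancy is the image of an element with trivial entry at m. It commutes with the image of
   factor m, which is everything, hence lies in the trivial center. *)
have pE x : p x = q (x i m).
  apply/eqP; rewrite eq_mulVg1; set z := _ * _.
  have cz : z \in 'Z([set: S i]).
    apply/centerP; split=> [|t _]; first by rewrite inE.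
    have /morphimP[u _ _ ->] : t \in qm @* [set: S i] by rewrite q_onto inE.
    rewrite /z /commute /= /q -pV -!pM; congr (p _); apply: prod_powP => i' k'.
    rewrite !prod_powM !prod_powV; have [eq_i|neq_i] := eqVneq i i'; last first.
      by rewrite !inj_coord_neq_factor // mulg1 mul1g.
    subst i'; have [<-|neq_k] := eqVneq m k'.
      by rewrite !inj_coord_id mulVg mulg1 mul1g.
    by rewrite !inj_coord_neq // mulg1 mul1g.
  have [Z1|ZT] := simpleSi _ (center_normal [group of [set: S i]]).
    by move: cz; rewrite (Z1 : 'Z([set: S i]) = 1) => /set1P->.
  by case/negP: nabSi; apply/center_idP.
exists m, (aut q_inj q_onto); split=> [|x]; first exact: Aut_aut.
by rewrite autE ?inE //; apply: pE.
Qed.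

End Coordinates.

(** * Delta fixes every coordinate *)

Section PermutationPart.

Variables (r : nat) (S : 'I_r -> finGroupType) (n : 'I_r -> nat).
Local Notation T := (prod_pow S n).
Hypothesis simpleS : forall i, simple [set: S i] /\ ~~ abelian [set: S i].
Hypothesis nonisoS :
  forall i j, i != j -> ~~ ([set: S i] \isog [set: S j]).

(** The labels of [split_word] record which twist of each generator is met along the path from m, so
    the twists multiply to its value. *)
Lemma carries_word (A : choiceType) (i : 'I_r) (sigma : A -> {perm 'I_(n i)})
    (g : A -> {perm T}) (h : A * nat -> {perm S i}) :
    (forall x m, carries (g x) m (sigma x m) (h (x, val m))) ->
  forall s m, carries (eval_word g s) m (eval_word sigma s m)
                (eval_word h (split_word sigma m s)).
Proof.
move=> gP; elim=> [|[x e] s IHs] m.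
  by rewrite /eval_word !big_nil perm1; apply: carries1.
rewrite !eval_word_cons permM; apply: carriesM (IHs _).
case: e => //=; apply: carriesV.
by rewrite -{2}(permKV (sigma x) m).
Qed.

Lemma base_aut_carries (f : {perm T}) :
    (forall i (k : 'I_(n i)),
       exists2 a, a \in Aut [set: S i] & carries f k k a) ->
  f \in base_aut S n.
Proof.
move=> fP.
have [a aP fa] := fin_all_exists2 (fun i => fin_all_exists2 (fP i)).
apply/base_autP; exists [ffun i => [ffun k => a i k]] => [i k|x i k].
  by rewrite !ffunE; apply: aP.
by rewrite !ffunE; apply: fa.
Qed.

Lemma aut_coordinates (f : {perm T}) i : f \in Aut [set: T] ->
  exists (sigma : {perm 'I_(n i)}) (a : 'I_(n i) -> {perm S i}),
    forall m, a m \in Aut [set: S i] /\ carries f m (sigma m) (a m).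
Proof.
move=> fAut.
have fP (k : 'I_(n i)) := aut_carries simpleS nonisoS k fAut.
have [pi /fin_all_exists[b bP]] := fin_all_exists fP.
have pi_inj : injective pi.
  move=> k l eq_pi; have [_ fk] := bP k; have [_ fl] := bP l.
  (* With a common source, f^-1 followed by f would carry l to k, yet the identity carries only k to
     k. *)
  have := carriesV fl; rewrite -eq_pi => fl'.
  have := carriesM fl' fk; rewrite mulVg => /(carries_inj simpleS (carries1 k)).
  by case.
exists (perm pi_inj)^-1, (fun m => b ((perm pi_inj)^-1 m)) => m.
have [bA fb] := bP ((perm pi_inj)^-1 m); split=> //.
by move: fb; rewrite -(permE pi_inj) permKV.
Qed.

Variables (A : finType) (w : free_group A) (i j : 'I_(size w)).
Hypothesis eq_xij : letter_var w i = letter_var w j.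
Hypothesis wmb_split : forall w' : free_group (A * nat)%type,
  split_variation i j w w' -> WMB w'.

(** A coordinate moved by Delta would turn a split variation of w into a coset identity: K contains
    all inner automorphisms, so its elements can be twisted independently at each coordinate without
    leaving the identity w. *)
Lemma Delta_base_aut (K : {group {perm T}}) (g : A -> {perm T}) :
    K \subset Aut [set: T] -> Inn [set: T] \subset K -> satisfies K w ->
    (forall x, g x \in K) ->
  eval_word g (Delta w i j) \in base_aut S n.
Proof.
move=> sKA sIK sKw Kg; have gA x := subsetP sKA _ (Kg x).
apply: base_aut_carries => q k.
have DA : eval_word g (Delta w i j) \in Aut [set: T] by apply: eval_word_in.
have [m [a [aA fa]]] := aut_carries simpleS nonisoS k DA.
suff eq_mk: m = k by rewrite eq_mk in fa; exists a.
apply/eqP; apply: contraT => neq_mk.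
have [sigma /fin_all_exists[b bP]] :=
  fin_all_exists (fun x => aut_coordinates q (gA x)).
(* Labels are naturals; those that are not coordinates get the dummy value at m. *)
pose alpha (y : A * nat) := b y.1 (insubd m y.2).
have alphaP x l : carries (g x) l (sigma x l) (alpha (x, val l)).
  by rewrite /alpha /= valKd; case: (bP x l).
have sigma_m : eval_word sigma (Delta w i j) m = k.
  pose m1 := (eval_word sigma (Delta w i j))^-1 k.
  have := carries_word alphaP (Delta w i j) m1; rewrite permKV.
  by move/(carries_inj simpleS fa) => [-> _]; rewrite permKV.
rewrite eval_Delta permM in sigma_m.
(* From the start o, the prefix of letter i leads to m and that of letter j to k, so the two letters
   get different labels. *)
set o := (eval_word sigma (prefix_of_letter w i))^-1 m in sigma_m.
have o_m : eval_word sigma (prefix_of_letter w i) o = m by rewrite permKV.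
pose w' := FreeGroup (split_word_reduced sigma o (word_ofP w)).
have splitw' : split_variation i j w w'.
  split=> //; first exact: split_wordK.
  rewrite /letter_var !onth_split_word o_m sigma_m -!/(letter_var _ _) eq_xij.
  have: letter_var w j by rewrite /letter_var onthTE size_map.
  by case: letter_var => //= x _ [] /val_inj/eqP; apply/negP.
have [simpleSq nabSq] := simpleS q.
have [_ /(_ _ [set: S q]%G simpleSq nabSq)[]] := wmb_split splitw'.
exists alpha => [y|]; first by case: (bP y.1 (insubd m y.2)).
suff w'1 h :
    (forall y, h y \in Inn [set: S q] :* alpha y) -> eval_word h w' = 1.
  by move=> h1 h2 h1P h2P; rewrite !w'1.
move=> hP.
have hE x (l : 'I_(n q)) : exists u,
    h (x, val l) = conj_aut [set: S q] u * alpha (x, val l).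
  have /rcosetP[_ /morphimP[u _ _ ->] ->] := hP (x, val l).
  by exists u.
have [s sP] := fin_all_exists (fun x => fin_all_exists (hE x)).
(* One socle element per variable realizes all the values h (x, l) at once, with its entries at the
   various coordinates l. *)
pose tau x : T := @dfung1 _ (fun p => pow_group (S p) (n p)) q (finfun (s x)).
pose g' x := conj_aut [set: T] (tau x) * g x.
have g'P x l : carries (g' x) l (sigma x l) (h (x, val l)).
  move=> z; rewrite permM alphaP sP permM !norm_conj_autE ?inE ?subsetT //.
  by rewrite !prod_powM prod_powV /tau dfung1_id ffunE.
have g'K x : g' x \in K.
  by rewrite groupM ?Kg // (subsetP sIK) // mem_morphim ?inE ?subsetT.
(* The identity w makes this product 1, and 1 carries o only to itself, with trivial twist. *)
have := carries_word g'P w o; rewrite (sKw g' g'K).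
by move/(carries_inj simpleS (carries1 _))=> [].
Qed.

End PermutationPart.

(** * Descent to the permutation part *)

Theorem theorem5p1p4 (d : nat) (w : free_group 'I_d) (i j : 'I_(size w))
    (lt_ij : (i < j)%N)
    (eq_xij : letter_var w i = letter_var w j)
    (wmb_split : forall w' : free_group ('I_d * nat)%type,
       split_variation i j w w' -> WMB w') :
  (forall (gT : finGroupType) (H : {group gT}),
     semisimple H -> satisfies H w ->
     forall (pT : finGroupType) (P : {group pT}),
       permutation_part H P -> satisfies P (Delta w i j)) /\
  (exists v : free_group 'I_d,
     [/\ v <> 1%g, (size v < size w)%N &
       forall (gT : finGroupType) (H : {group gT}),
         semisimple H -> satisfies H w ->
         forall (pT : finGroupType) (P : {group pT}),
           permutation_part H P -> satisfies P v]).
Proof.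
have satP (gT : finGroupType) (H : {group gT}) : satisfies H w ->
    forall (pT : finGroupType) (P : {group pT}),
    permutation_part H P -> satisfies P (Delta w i j).
  move=> Hw pT P; rewrite /permutation_part; case: ifP => _.
    move=> P1 g Pg; apply/set1P; rewrite -[[set 1]]/(1 : {set pT}) -P1.
    exact: eval_word_in.
  case=> r [S [n [phi [simpleS nonisoS _ [_ sKA sIK _] isoP]]]].
  rewrite isog_sym in isoP; apply: satisfies_isog isoP _.
  have Kw : satisfies (phi @* H) w.
    apply: satisfies_morphim => g Hg.
    by rewrite Hw ?morph1 // => x; have /setIP[] := Hg x.
  apply: satisfies_morphim => g Ng.
  have Kg x : g x \in phi @* H by have /setIP[] := Ng x.
  (* Being trivial in P(H) means lying in the base group, that is, fixing all coordinates. *)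
  apply/coset_id; rewrite inE; apply/andP; split; first exact: eval_word_in.
  exact: (Delta_base_aut simpleS nonisoS eq_xij wmb_split sKA sIK Kw Kg).
split=> [gT H _|]; first exact: satP.
have [v [v1 lt_v vP]] := Delta_or_conjugate lt_ij eq_xij.
by exists v; split=> // gT H _ Hw pT P HP; apply/vP/(satP gT H).
Qed.
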